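(* Let $K\subseteq\mathbb{R}^m$ be a closed pointed convex cone with nonempty interior, $\{0_m\}\neq K\subsetneq\mathbb{R}^m$, and let $\overline{A}=[\overline a_1\mid\dots\mid\overline a_m]^T\in\mathbb{R}^{m\times n}$, $\overline b\in\mathbb{R}^m$ be such that $\{x\in\mathbb{R}^n:\overline Ax+\overline b\in -K\}\neq\emptyset$. Let $\mathcal{B}$ be a compact base of $K^\ast$. Then the radius of robust feasibility satisfies $$C_1\,\mathrm{dist}\big(0_{n+1},E(\overline A,\overline b,\mathcal B)\big)\le \rho(\overline A,\overline b)\le C_2\,\mathrm{dist}\big(0_{n+1},E(\overline A,\overline b,\mathcal B)\big),$$ where $$C_1=1/\max\Big\{\Big\|\sum_{i=1}^m\lambda_iu_i\Big\|:\lambda\in\mathcal B,\ u_i\in\mathbb{R}^{n+1},\ \|u_i\|\le 1,\ i=1,\dots,m\Big\},$$ $$C_2=1/\min\Big\{\sum_{i=1}^m|\lambda_i|:\lambda\in\mathcal B\Big\}.$$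
   Context: $\|\cdot\|$ is the Euclidean norm, $\mathbb{B}_{k}$ the closed Euclidean unit ball of $\mathbb{R}^k$, $\mathrm{dist}(x,X)=\inf_{y\in X}\|x-y\|$. The dual cone is $K^\ast=\{a\in\mathbb{R}^m:a^Tx\ge 0\ \forall x\in K\}$. A compact base of $K^\ast$ is a compact convex set $\mathcal B\subseteq K^\ast$ with $0_m\notin\mathcal B$ and $K^\ast=\mathbb{R}_+\mathcal B$. For $r\in\mathbb{R}^m_+$, the robust feasible set is $$F_r(\overline A,\overline b)=\{x\in\mathbb{R}^n: (a_1^Tx+b_1,\dots,a_m^Tx+b_m)^T\in -K\ \ \forall (a_i,b_i)\in(\overline a_i,\overline b_i)+r_i\mathbb{B}_{n+1},\ i=1,\dots,m\}.$$ The admissible set is $C(\overline A,\overline b)=\{r\in\mathbb{R}^m_+:F_r(\overline A,\overline b)\ne\emptyset\}$, and the radius of robust feasibility is $\rho(\overline A,\overline b)=\sup\{\alpha\in\mathbb{R}_+:\alpha 1_m\in C(\overline A,\overline b)\}$, with $1_m$ the all-ones vector. The epigraphical set is $E(\overline A,\overline b,\mathcal B)=\{(\overline A^T\lambda,\,-\overline b^T\lambda):\lambda\in\mathcal B\}+\{0_n\}\times\mathbb{R}_+\subseteq\mathbb{R}^{n+1}$. *)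

(* Defs.v *)
From HB Require Import structures.
From mathcomp Require Import all_boot all_order all_algebra.
From mathcomp Require Import all_classical all_reals all_analysis.

Set Implicit Arguments.
Unset Strict Implicit.
Unset Printing Implicit Defensive.

Import Order.TTheory GRing.Theory Num.Theory.
Import numFieldNormedType.Exports.

Local Open Scope classical_set_scope.
Local Open Scope ring_scope.

(* R^k is 'cV[R]_k. The norm `|x| that the library puts on matrices is the sup
   norm, so the Euclidean norm is defined here. Both norms induce the topology
   carried by 'cV[R]_k. *)
Definition enorm (R : realType) (k : nat) (x : 'cV[R]_k) : R :=
  Num.sqrt (\sum_i x i 0 ^+ 2).

Definition unit_ball (R : realType) (k : nat) : set 'cV[R]_k :=
  [set x : 'cV[R]_k | enorm x <= 1].

(* Extended-real valued: the distance to the empty set is +oo. *)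
Definition euclid_dist (R : realType) (k : nat) (x : 'cV[R]_k)
    (X : set 'cV[R]_k) : \bar R :=
  ereal_inf [set (enorm (x - y))%:E | y in X].

Definition is_max (R : realType) (S : set R) (v : R) := S v /\ ubound S v.
Definition is_min (R : realType) (S : set R) (v : R) := S v /\ lbound S v.

Definition cone (R : realType) (m : nat) (K : set 'cV[R]_m) :=
  forall (t : R) x, 0 <= t -> K x -> K (t *: x).

Definition pointed (R : realType) (m : nat) (K : set 'cV[R]_m) :=
  K `&` (-%R @` K) = [set 0].

Definition dual_cone (R : realType) (m : nat) (K : set 'cV[R]_m) :
    set 'cV[R]_m :=
  [set a : 'cV[R]_m | forall x, K x -> 0 <= (a^T *m x) 0 0].

Definition compact_base (R : realType) (m : nat) (D B : set 'cV[R]_m) :=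
  [/\ compact B, convex_set B, B `<=` D, ~ B 0 &
      D = [set t *: a | t in [set t : R | 0 <= t] & a in B]].

Section RobustFeasibility.
Variables (R : realType) (m n : nat) (K : set 'cV[R]_m).
Variables (A : 'M[R]_(m, n)) (b : 'cV[R]_m).

(* The point (a, beta) of R^n x R = R^(n+1). *)
Definition mkpair (a : 'cV[R]_n) (beta : R) : 'cV[R]_(n + 1) :=
  col_mx a beta%:M.

Definition robust_feasible_set (r : 'cV[R]_m) : set 'cV[R]_n :=
  [set x : 'cV[R]_n | forall (a : 'I_m -> 'cV[R]_n) (beta : 'I_m -> R),
     (forall i, [set mkpair (row i A)^T (b i 0) + r i 0 *: u
                | u in @unit_ball R (n + 1)] (mkpair (a i) (beta i))) ->
     (-%R @` K) (\col_i (((a i)^T *m x) 0 0 + beta i))].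

Definition admissible_set : set 'cV[R]_m :=
  [set r : 'cV[R]_m | (forall i, 0 <= r i 0) /\ robust_feasible_set r !=set0].

(* Extended-real valued: +oo when the set of admissible alpha is unbounded. *)
Definition radius_robust_feasibility : \bar R :=
  ereal_sup [set alpha%:E | alpha in
    [set alpha : R | 0 <= alpha /\ admissible_set (alpha *: const_mx 1)]].

Definition epigraphical_set (B : set 'cV[R]_m) : set 'cV[R]_(n + 1) :=
  [set mkpair (A^T *m lambda) (- ((b^T *m lambda) 0 0)) + mkpair 0 s
  | lambda in B & s in [set s : R | 0 <= s]].

End RobustFeasibility.

(* Main.v *)
(* Maximising the robust constraint over the perturbation balls shows that
   [alpha] is admissible iff some [x] satisfies
     l^T (A x + b) + alpha |l|_1 |(x, 1)| <= 0   for all [l] in the base,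
   because [K] is the polar of its dual cone. Since
   [l^T (A x + b) = - <(A^T l, - b^T l), (- x, 1)>], Cauchy-Schwarz against the
   points of the epigraphical set gives the upper bound, with [mu] the minimum
   of [|l|_1]. Conversely the point [p] of least norm of the epigraphical set
   satisfies [<p, z> >= |p|^2] on it, so after a small perturbation making its
   last coordinate positive, [p] is a positive multiple of a vector [(- x, 1)]
   whose [x] is robust feasible as soon as [alpha * M < |p|], where [M], the
   maximum of [|l|_1], is also the maximum of [|\sum_i l_i u_i|]. *)
Require Import Defs.
From HB Require Import structures.
From mathcomp Require Import all_boot all_order all_algebra.
From mathcomp Require Import all_classical all_reals all_analysis.
From mathcomp Require Import ring lra.

Set Implicit Arguments.
Unset Strict Implicit.
Unset Printing Implicit Defensive.

Import Order.TTheory GRing.Theory Num.Theory.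
Import numFieldNormedType.Exports.

Local Open Scope classical_set_scope.
Local Open Scope ring_scope.

(** * Dot product and Euclidean norm *)

Definition dot (R : realType) (k : nat) (u v : 'cV[R]_k) : R :=
  (u^T *m v) 0 0.

Section DotProduct.
Variables (R : realType) (k : nat).
Implicit Types (u v w : 'cV[R]_k) (t : R).

Lemma dotE u v : dot u v = \sum_i u i 0 * v i 0.
Proof. by rewrite /dot mxE; apply: eq_bigr => i _; rewrite mxE. Qed.

Lemma dotC u v : dot u v = dot v u.
Proof. by rewrite !dotE; apply: eq_bigr => i _; rewrite mulrC. Qed.

Lemma dotDl u v w : dot (u + v) w = dot u w + dot v w.
Proof. by rewrite /dot linearD/= mulmxDl mxE. Qed.

Lemma dotDr u v w : dot w (u + v) = dot w u + dot w v.
Proof. by rewrite dotC dotDl !(dotC w). Qed.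

Lemma dotZl t u v : dot (t *: u) v = t * dot u v.
Proof. by rewrite /dot linearZ/= -scalemxAl mxE. Qed.

Lemma dotZr t u v : dot u (t *: v) = t * dot u v.
Proof. by rewrite dotC dotZl dotC. Qed.

Lemma dotNl u v : dot (- u) v = - dot u v.
Proof. by rewrite -scaleN1r dotZl mulN1r. Qed.

Lemma dotNr u v : dot u (- v) = - dot u v.
Proof. by rewrite dotC dotNl dotC. Qed.

Lemma dot0r u : dot u 0 = 0.
Proof. by rewrite -(scale0r 0) dotZr mul0r. Qed.

Lemma dot_suml (I : finType) (f : I -> 'cV[R]_k) v :
  dot (\sum_i f i) v = \sum_i dot (f i) v.
Proof.
elim/big_rec2 : _ => [|i x y _ <-]; last by rewrite dotDl.
by rewrite dotC dot0r.
Qed.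

Lemma dot_ge0 u : 0 <= dot u u.
Proof. by rewrite dotE sumr_ge0// => i _; rewrite -expr2 sqr_ge0. Qed.

Lemma dot_eq0 u : dot u u = 0 -> u = 0.
Proof.
move=> /eqP; rewrite dotE psumr_eq0 => [/allP u0|i _]; last first.
  by rewrite -expr2 sqr_ge0.
apply/colP => i; rewrite mxE; apply/eqP.
by have := u0 i (mem_index_enum _); rewrite /= mulf_eq0 orbb.
Qed.

Lemma enormE u : enorm u = Num.sqrt (dot u u).
Proof. by rewrite /enorm dotE; under eq_bigr do rewrite expr2. Qed.

Lemma enorm_ge0 u : 0 <= enorm u.
Proof. by rewrite sqrtr_ge0. Qed.

Lemma sqr_enorm u : enorm u ^+ 2 = dot u u.
Proof. by rewrite enormE sqr_sqrtr// dot_ge0. Qed.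

Lemma enormZ t u : enorm (t *: u) = `|t| * enorm u.
Proof.
by rewrite !enormE dotZl dotZr mulrA -expr2 sqrtrM ?sqr_ge0// sqrtr_sqr.
Qed.

Lemma enormN u : enorm (- u) = enorm u.
Proof. by rewrite -scaleN1r enormZ normrN normr1 mul1r. Qed.

(** For [v] nonzero, the square of [(v.v) u - (u.v) v] expands to [v.v] times
    [(u.u)(v.v) - (u.v)^2], so the latter factor is nonnegative. *)
Lemma cauchy_schwarz_dot u v : dot u v <= enorm u * enorm v.
Proof.
have [v0|v0] := eqVneq (dot v v) 0.
  by rewrite (dot_eq0 v0) dot0r mulr_ge0// enorm_ge0.
have vgt0 : 0 < dot v v by rewrite lt_neqAle eq_sym v0 dot_ge0.
have := dot_ge0 (dot v v *: u - dot u v *: v).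
rewrite !(dotDl, dotDr, dotNl, dotNr, dotZl, dotZr) (dotC v u) => h.
rewrite (le_trans (ler_norm _))// -(@ler_pXn2r _ 2)// ?nnegrE//; last first.
  by rewrite mulr_ge0 ?enorm_ge0.
rewrite exprMn !sqr_enorm real_normK ?num_real//.
rewrite -(ler_pM2l vgt0) -subr_ge0.
by apply: le_trans h _; rewrite le_eqVlt; apply/orP; left; apply/eqP; ring.
Qed.

Lemma enormD u v : enorm (u + v) <= enorm u + enorm v.
Proof.
rewrite -(@ler_pXn2r _ 2)// ?nnegrE ?addr_ge0 ?enorm_ge0//.
rewrite sqr_enorm sqrrD !sqr_enorm dotDl !dotDr (dotC v u).
by have := cauchy_schwarz_dot u v; lra.
Qed.

Lemma enorm_sum (I : finType) (f : I -> 'cV[R]_k) :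
  enorm (\sum_i f i) <= \sum_i enorm (f i).
Proof.
elim/big_rec2 : _ => [|i x y _ h]; first by rewrite enormE dot0r sqrtr0.
by rewrite (le_trans (enormD _ _))// lerD2l.
Qed.

Lemma coord_le_enorm u i : `|u i 0| <= enorm u.
Proof.
rewrite -sqrtr_sqr enormE ler_wsqrtr// dotE (bigD1 i)//= expr2 lerDl.
by apply: sumr_ge0 => j _; rewrite -expr2 sqr_ge0.
Qed.

(* The derivative of [|p + t (y - p)|^2] at [t = 0+] is nonnegative. *)
Lemma min_norm_variational (C : set 'cV[R]_k) (p y : 'cV[R]_k) :
  (forall z, C z -> dot p p <= dot z z) ->
  (forall t, 0 < t -> t <= 1 -> C (t *: y + (1 - t) *: p)) ->
  dot p p <= dot p y.
Proof.
move=> pmin segC; rewrite leNgt; apply/negP => lt_py.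
set D := dot p p - dot p y; have D0 : 0 < D by rewrite subr_gt0.
(* [Q] bounds both [D] and [|y - p|^2], because [-2 p.y <= p.p + y.y]. Hence [t = D / Q] is at most
   1, and moving by [t] lowers the squared norm by at least [t * D]. *)
set Q := 2 * dot p p + 2 * dot y y + 1.
have := dot_ge0 (p + y); rewrite dotDl !dotDr (dotC y p) => pyD.
have [p_ge0 y_ge0] := (dot_ge0 p, dot_ge0 y).
have Q0 : 0 < Q by rewrite /Q; lra.
have t0 : 0 < D / Q by rewrite divr_gt0.
have t1 : D / Q <= 1 by rewrite ler_pdivrMr// /D /Q; lra.
have := pmin _ (segC _ t0 t1).
have tQ : D / Q * Q = D by rewrite divfK ?lt0r_neq0.
move: t0 t1 tQ; set t := D / _ => t0 t1 tQ.
have -> : dot (t *: y + (1 - t) *: p) (t *: y + (1 - t) *: p) =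
    dot p p - 2 * (t * D) + t * (t * (dot p p - 2 * dot p y + dot y y)).
  by rewrite !dotDl !dotDr !(dotZl, dotZr) (dotC y p) /D; ring.
have : t * (dot p p - 2 * dot p y + dot y y) <= t * Q.
  by rewrite ler_pM2l// /Q; lra.
rewrite tQ => h; have := ler_wpM2l (ltW t0) h.
by have := mulr_gt0 t0 D0; lra.
Qed.

End DotProduct.

(** * Continuity, and points of least norm in closed sets *)

Lemma continuous_sumr (T : topologicalType) (R : realType) (I : Type)
    (r : seq I) (f : I -> T -> R) :
  (forall i, continuous (f i)) -> continuous (fun x => \sum_(i <- r) f i x).
Proof.
move=> fc; elim: r => [|i r IH].
  by under eq_fun do rewrite big_nil; move=> x; exact: cvg_cst.
under eq_fun do rewrite big_cons.
by move=> x; apply: cvgD; [exact: fc|exact: IH].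
Qed.

Lemma continuous_mulmx_coord (R : realType) (k l : nat) (M : 'M[R]_(l, k)) i :
  continuous (fun v : 'cV[R]_k => (M *m v) i 0).
Proof.
under eq_fun do rewrite mxE.
apply: continuous_sumr => j x.
exact: (continuous_comp (@coord_continuous R k 1 j 0 x)
  (@mulrl_continuous R (M i j) _)).
Qed.

Lemma trmx_continuous (R : realType) (k l : nat) :
  continuous (@trmx R k l).
Proof.
by move=> x S [P xP PS]; exists (fun i j => P j i) => [i j|y yP];
  [have := xP j i; rewrite mxE|apply: PS => i j; rewrite mxE; exact: yP].
Qed.

Lemma dot_self_continuous (R : realType) (k : nat) :
  continuous (fun v : 'cV[R]_k => dot v v).
Proof.
under eq_fun do rewrite dotE.
apply: continuous_sumr => i x.
have xi := @coord_continuous R k 1 i 0 x; exact: (cvgM xi xi).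
Qed.

(** Points no longer than a fixed [c] in [C] lie in a compact box, and longer points cannot beat
    [c]. The box is taken in row vectors, where [rV_compact] applies, and carried over by
    transposition. *)
Lemma ex_min_norm_closed (R : realType) (k : nat) (C : set 'cV[R]_k) :
  closed C -> C !=set0 ->
  exists2 p, C p & forall z, C z -> dot p p <= dot z z.
Proof.
move=> Cclosed [c Cc].
pose box := [set v : 'rV[R]_k | forall i,
  `[- enorm c, enorm c]%classic (v ord0 i)].
have box_le (z : 'cV[R]_k) : dot z z <= dot c c -> box z^T.
  move=> zc i; rewrite /= mxE in_itv/= -ler_norml.
  by rewrite (le_trans (coord_le_enorm _ _))// !enormE ler_wsqrtr.
pose D := box `&` trmx @^-1` C.
have Dcompact : compact D.
  apply: compact_closedI.
    apply: (@rV_compact R k (fun=> `[- enorm c, enorm c]%classic)) => _.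
    exact: segment_compact.
  by apply: preimage_closed => // x _; exact: trmx_continuous.
have D0 : D !=set0 by exists c^T; split; [exact: box_le|rewrite /= trmxK].
have [|p /set_mem[_ Cp] pmin] :=
    @compact_EVT_min _ R (fun v : 'rV_k => dot v^T v^T) D D0 Dcompact.
  apply: continuous_subspaceT => x.
  apply: (@continuous_comp _ _ _ trmx (fun v : 'cV[R]_k => dot v v)).
    exact: trmx_continuous.
  exact: dot_self_continuous.
have pminD z : C z -> dot z z <= dot c c -> dot p^T p^T <= dot z z.
  move=> Cz zc; rewrite -[z in leRHS]trmxK; apply: pmin; apply/mem_set.
  by split; [exact: box_le|rewrite /= trmxK].
exists p^T => // z Cz; have [|/ltW cz] := leP (dot z z) (dot c c).
  exact: pminD.
exact: le_trans (pminD c Cc (lexx _)) cz.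
Qed.

(** * Separation of a point from a closed convex cone *)

Lemma convex_setP (R : realType) (k : nat) (C : set 'cV[R]_k) :
  convex_set C ->
  forall x y t, C x -> C y -> 0 <= t -> t <= 1 -> C (t *: x + (1 - t) *: y).
Proof.
move=> cC x y t Cx Cy t0 t1.
by have /set_mem := cC x y (Itv01 t0 t1) (mem_set Cx) (mem_set Cy).
Qed.

(** The separating vector [a] is the point of least norm of [K - z], that is, the projection of [z]
    on [K] minus [z]. *)
Lemma cone_separation (R : realType) (k : nat) (K : set 'cV[R]_k)
    (z : 'cV[R]_k) :
  closed K -> convex_set K -> cone K -> K !=set0 -> ~ K z ->
  exists2 a, dual_cone K a & dot a z < 0.
Proof.
move=> Kclosed Kconvex Kcone [k0 Kk0] nKz.
have K0 : K 0 by rewrite -(scale0r k0); exact: Kcone.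
pose C := (fun v : 'cV[R]_k => v + z) @^-1` K.
have Cclosed : closed C.
  apply: preimage_closed => // x _.
  exact: (@cvgD _ _ _ (nbhs x) _ id (cst z) x z (@cvg_id _ _) (cvg_cst z)).
have [|a Ka amin] := ex_min_norm_closed Cclosed.
  by exists (- z); rewrite /C /= addNr.
have a_var y : K y -> dot a a <= dot a (y - z).
  move=> Ky; apply: (min_norm_variational amin) => t t0 t1; rewrite /C /=.
  have -> : t *: (y - z) + (1 - t) *: a + z = t *: y + (1 - t) *: (a + z).
    by apply/colP => j; rewrite !mxE; ring.
  by apply: convex_setP => //; exact: ltW.
have a_gt0 : 0 < dot a a.
  rewrite lt_neqAle dot_ge0 andbT eq_sym; apply/eqP => /dot_eq0 a0.
  by apply: nKz; move: Ka; rewrite a0 /C /= add0r.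
have az_lt0 : dot a z < 0 by have := a_var 0 K0; rewrite sub0r dotNr; lra.
exists a => // x Kx; rewrite -/(dot a x) leNgt; apply/negP => ax_lt0.
(* The multiple of [x] having the same product with [a] as [z]: at this point of [K] the variational
   inequality becomes [|a|^2 <= 0]. *)
have t0 : 0 <= dot a z / dot a x by rewrite -mulrNN -invrN divr_ge0// oppr_ge0 ltW.
have := a_var _ (Kcone _ _ t0 Kx).
by rewrite dotDr dotNr dotZr divfK ?lt_eqF// subrr; lra.
Qed.

(** * Block computations in R^n x R *)

Section Mkpair.
Variables (R : realType) (n : nat).
Implicit Types (a c : 'cV[R]_n) (s t : R).

Lemma dot_mkpair a s c t : dot (mkpair a s) (mkpair c t) = dot a c + s * t.
Proof.
rewrite /dot /mkpair tr_col_mx mul_row_col mxE tr_scalar_mx -scalar_mxM.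
by rewrite [X in _ + X]mxE eqxx mulr1n.
Qed.

Lemma mkpairD a s c t : mkpair a s + mkpair c t = mkpair (a + c) (s + t).
Proof. by rewrite /mkpair add_col_mx raddfD. Qed.

Lemma mkpairZ t a s : t *: mkpair a s = mkpair (t *: a) (t * s).
Proof. by rewrite /mkpair scale_col_mx scale_scalar_mx. Qed.

Lemma mkpairK (v : 'cV[R]_(n + 1)) : mkpair (usubmx v) (dsubmx v 0 0) = v.
Proof. by rewrite /mkpair -mx11_scalar vsubmxK. Qed.

Lemma dot_mkpair01 (v : 'cV[R]_(n + 1)) : dot v (mkpair 0 1) = dsubmx v 0 0.
Proof. by rewrite -[v in LHS]mkpairK dot_mkpair dot0r add0r mulr1. Qed.

Lemma enorm_mkpairN a t : enorm (mkpair (- a) t) = enorm (mkpair a t).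
Proof. by rewrite !enormE !dot_mkpair dotNl dotNr opprK. Qed.

Lemma enorm_mkpair1_gt0 a : 0 < enorm (mkpair a 1).
Proof.
by rewrite enormE sqrtr_gt0 dot_mkpair mulr1 ltr_wpDl// dot_ge0.
Qed.

End Mkpair.

(** * The l1 norm and weighted sums of unit ball vectors *)

Definition l1norm (R : realType) (m : nat) (l : 'cV[R]_m) : R :=
  \sum_(i < m) `|l i 0|.

Lemma l1norm_continuous (R : realType) (m : nat) :
  continuous (@l1norm R m).
Proof.
apply: continuous_sumr => i x.
have xi := @coord_continuous R m 1 i 0 x; exact: (cvg_norm xi).
Qed.

Lemma l1norm_gt0 (R : realType) (m : nat) (l : 'cV[R]_m) :
  l <> 0 -> 0 < l1norm l.
Proof.
move=> l0; rewrite lt_neqAle sumr_ge0// andbT eq_sym.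
apply/eqP => /eqP; rewrite psumr_eq0// => /allP l1; apply: l0.
apply/colP => i; rewrite mxE; apply/eqP; rewrite -normr_eq0.
exact: l1 (mem_index_enum _).
Qed.

Lemma enorm_weighted_sum_le (R : realType) (m k : nat) (l : 'cV[R]_m)
    (u : 'I_m -> 'cV[R]_k) :
  (forall i, enorm (u i) <= 1) -> enorm (\sum_i l i 0 *: u i) <= l1norm l.
Proof.
move=> u1; apply: le_trans (enorm_sum _) _.
by apply: ler_sum => i _; rewrite enormZ ler_piMr.
Qed.

Lemma weighted_sum_sg (R : realType) (m k : nat) (l : 'cV[R]_m)
    (v : 'cV[R]_k) :
  \sum_i l i 0 *: (Num.sg (l i 0) *: v) = l1norm l *: v.
Proof.
rewrite scaler_suml; apply: eq_bigr => i _.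
by rewrite scalerA mulrC -normrEsg.
Qed.

(** Only an inequality survives, since [Num.sg 0 = 0]. *)
Lemma enorm_sgZ_le (R : realType) (k : nat) (t : R) (v : 'cV[R]_k) :
  enorm v <= 1 -> enorm (Num.sg t *: v) <= 1.
Proof.
move=> v1; rewrite enormZ normr_sg.
by case: (t != 0); rewrite ?mul1r// mul0r.
Qed.

(** The triangle inequality bounds the weighted sum by [l1norm]; equality holds when every [u i] is
    the same unit vector [e] up to the sign of [l i 0]. *)
Lemma is_max_weighted_sum (R : realType) (m k : nat) (B : set 'cV[R]_m)
    (l : 'cV[R]_m) (e : 'cV[R]_k) :
  enorm e = 1 -> B l -> (forall l', B l' -> l1norm l' <= l1norm l) ->
  is_max [set v : R | exists (lambda : 'cV[R]_m) (u : 'I_m -> 'cV[R]_k),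
    [/\ B lambda, forall i, enorm (u i) <= 1 &
        v = enorm (\sum_(i < m) lambda i 0 *: u i)]] (l1norm l).
Proof.
move=> e1 Bl lmax; split=> [|_ [l' [u [Bl' u1 ->]]]].
  exists l, (fun i => Num.sg (l i 0) *: e); split=> //.
    by move=> i; rewrite enorm_sgZ_le ?e1.
  by rewrite weighted_sum_sg enormZ e1 mulr1 ger0_norm ?sumr_ge0.
by rewrite (le_trans (enorm_weighted_sum_le _ u1))// lmax.
Qed.

(** * Describing [- K] by a base of the dual cone *)

Section DualBase.
Variables (R : realType) (m : nat) (K B : set 'cV[R]_m).
Hypotheses (Kclosed : closed K) (Kconvex : convex_set K) (Kcone : cone K).
Hypotheses (K0 : K !=set0) (Bbase : compact_base (dual_cone K) B).

Lemma compact_base_nonempty : B !=set0.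
Proof.
have [_ _ _ _ defD] := Bbase.
have : dual_cone K 0 by move=> x _; rewrite -/(dot 0 x) dotC dot0r.
by rewrite defD => -[t _ [l Bl _]]; exists l.
Qed.

(** Bipolar argument: if [- y] is outside [K], a separating dual vector is [t *: l] with [t >= 0]
    and [l] in [B], and [l] then violates the inequality. *)
Lemma opp_coneP (y : 'cV[R]_m) :
  (-%R @` K) y <-> forall l, B l -> dot l y <= 0.
Proof.
have [_ _ BD _ defD] := Bbase; split=> [[k Kk <-] l /BD Dl|Bl].
  by rewrite dotNr oppr_le0; exact: Dl.
have [Ky|nKy] := pselect (K (- y)); first by exists (- y); rewrite ?opprK.
have [a] := cone_separation Kclosed Kconvex Kcone K0 nKy.
rewrite defD => -[t /= t0 [l /Bl ly <-]].
by rewrite dotNr dotZl oppr_lt0 ltNge mulr_ge0_le0.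
Qed.

End DualBase.

Lemma euclid_dist_min (R : realType) (k : nat) (E : set 'cV[R]_k) (p : 'cV[R]_k) :
  E p -> (forall z, E z -> dot p p <= dot z z) ->
  euclid_dist 0 E = (enorm p)%:E.
Proof.
move=> Ep pmin; apply/eqP; rewrite eq_le; apply/andP; split.
  by apply: ereal_inf_lbound; exists p => //; rewrite sub0r enormN.
apply/ereal_infP => _ [z Ez <-].
by rewrite lee_fin sub0r enormN !enormE ler_wsqrtr// pmin.
Qed.

(** * Admissible radii and the epigraphical set *)

Section RobustRadius.
Variables (R : realType) (m n : nat) (K B : set 'cV[R]_m).
Variables (A : 'M[R]_(m, n)) (b : 'cV[R]_m).
Hypotheses (Kclosed : closed K) (Kconvex : convex_set K) (Kcone : cone K).
Hypotheses (K0 : K !=set0) (Bbase : compact_base (dual_cone K) B).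

Let opp_K := opp_coneP Kclosed Kconvex Kcone K0 Bbase.

Lemma perturbed_row (x : 'cV[R]_n) (i : 'I_m) (a : 'cV[R]_n) (beta alpha : R)
    (u : 'cV[R]_(n + 1)) :
  mkpair a beta = mkpair (row i A)^T (b i 0) + alpha *: u ->
  (a^T *m x) 0 0 + beta = (A *m x + b) i 0 + alpha * dot u (mkpair x 1).
Proof.
move=> e; rewrite -/(dot a x) -[beta in LHS]mulr1 -dot_mkpair e dotDl dotZl.
by rewrite dot_mkpair mulr1 /dot trmxK -row_mul !mxE.
Qed.

Lemma dot_perturbed (l y : 'cV[R]_m) (k : nat) (u : 'I_m -> 'cV[R]_k) w alpha :
  dot l (\col_i (y i 0 + alpha * dot (u i) w)) =
  dot l y + alpha * dot (\sum_i l i 0 *: u i) w.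
Proof.
rewrite dot_suml !(dotE l) mulr_sumr -big_split/=; apply: eq_bigr => i _.
by rewrite mxE dotZl; ring.
Qed.

(* Maximising over the perturbations [u i] of the unit ball turns the robust
   constraint into one inequality for each multiplier [l] of the base. *)
Lemma admissible_setP (alpha : R) : 0 <= alpha ->
  admissible_set K A b (alpha *: const_mx 1) <->
  exists x, forall l, B l ->
    dot l (A *m x + b) + alpha * (l1norm l * enorm (mkpair x 1)) <= 0.
Proof.
move=> alpha0; have radius i : (alpha *: const_mx 1 : 'cV[R]_m) i 0 = alpha.
  by rewrite !mxE mulr1.
split=> [[_ [x xrob]]|[x xB]].
  exists x => l Bl; set w := mkpair x 1.
  have w0 : 0 < enorm w by exact: enorm_mkpair1_gt0.
  pose v := (enorm w)^-1 *: w.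
  have v1 : enorm v <= 1.
    by rewrite enormZ gtr0_norm ?invr_gt0// mulVf ?gt_eqF.
  (* Worst perturbation for [l]: all directions are parallel to [(x, 1)], with signs chosen so that
     the contributions add up. *)
  pose u i := Num.sg (l i 0) *: v.
  pose z i := mkpair (row i A)^T (b i 0) + alpha *: u i.
  have /xrob : forall i, [set mkpair (row i A)^T (b i 0)
      + (alpha *: const_mx 1 : 'cV[R]_m) i 0 *: u
      | u in @unit_ball R (n + 1)] (mkpair (usubmx (z i)) (dsubmx (z i) 0 0)).
    move=> i; rewrite radius mkpairK; exists (u i) => //.
    exact: enorm_sgZ_le.
  under eq_mx do rewrite (perturbed_row x (mkpairK (z _))).
  move/opp_K => /(_ l Bl); rewrite dot_perturbed weighted_sum_sg.
  by rewrite !dotZl -sqr_enorm expr2 mulKf ?gt_eqF.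
split=> [i|]; first by rewrite radius.
exists x => a beta ab.
have /choice[u uP] : forall i, exists u : 'cV[R]_(n + 1), enorm u <= 1 /\
    ((a i)^T *m x) 0 0 + beta i = (A *m x + b) i 0 + alpha * dot u (mkpair x 1).
  move=> i; have [u u1 ui] := ab i; exists u; split=> //.
  by apply: perturbed_row; rewrite -ui radius.
apply/opp_K => l Bl; under eq_mx do rewrite (uP _).2.
rewrite dot_perturbed; apply: le_trans (xB l Bl).
rewrite lerD2l ler_wpM2l//; apply: le_trans (cauchy_schwarz_dot _ _) _.
rewrite ler_wpM2r ?enorm_ge0// enorm_weighted_sum_le// => i.
exact: (uP i).1.
Qed.

Lemma dot_epigraph (l : 'cV[R]_m) (s c : R) (x : 'cV[R]_n) :
  dot (mkpair (A^T *m l) (- dot b l) + mkpair 0 s) (mkpair x c) =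
  dot l (A *m x) + (s - dot b l) * c.
Proof.
by rewrite mkpairD addr0 dot_mkpair {1}/dot trmx_mul trmxK -mulmxA (addrC s).
Qed.

Lemma epigraphical_set_convex (y z : 'cV[R]_(n + 1)) (t : R) :
  epigraphical_set A b B y -> epigraphical_set A b B z -> 0 <= t -> t <= 1 ->
  epigraphical_set A b B (t *: y + (1 - t) *: z).
Proof.
have [_ cB _ _ _] := Bbase.
move=> [l Bl [s /= s0 <-]] [l' Bl' [s' /= s'0 <-]] t0 t1.
exists (t *: l + (1 - t) *: l'); first exact: convex_setP.
exists (t * s + (1 - t) * s') => /=.
  by rewrite addr_ge0// mulr_ge0// subr_ge0.
rewrite -!/(dot _ _) !(mkpairD, mkpairZ) !(addr0, dotDr, dotZr).
congr mkpair; last by ring.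
by rewrite mulmxDr -!scalemxAr.
Qed.

(* For fixed [l] the point of the epigraphical set closest to [0] has last
   coordinate [max(0, - b^T l)], so it remains to minimise over the compact
   base. *)
Lemma ex_min_norm_epigraphical_set :
  exists2 p, epigraphical_set A b B p &
    forall z, epigraphical_set A b B z -> dot p p <= dot z z.
Proof.
have [cB _ _ _ _] := Bbase.
pose h := (cst 0 : 'cV[R]_m -> R^o) \max (fun l => - (b^T *m l) 0 0 : R^o).
pose f (l : 'cV[R]_m) : R := dot (A^T *m l) (A^T *m l) + h l * h l.
have [|l /set_mem Bl lmin] :=
    @compact_EVT_min _ R f B (compact_base_nonempty Bbase) cB.
  apply: continuous_subspaceT => x.
  have hx : {for x, continuous h}.
    apply: (continuous_max (cvg_cst _)).
    exact: (cvgN (@continuous_mulmx_coord R m 1 b^T 0 x)).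
  have Ax : continuous (fun l : 'cV[R]_m => dot (A^T *m l) (A^T *m l)).
    under eq_fun do rewrite dotE.
    apply: continuous_sumr => i y.
    have yi := @continuous_mulmx_coord R m n A^T i y; exact: (cvgM yi yi).
  exact: (cvgD (Ax x) (cvgM hx hx)).
have hE l' : h l' = Num.max 0 (- dot b l') by [].
(* The vertical shift [h l + dot b l] is nonnegative and brings the last coordinate from [- b^T l]
   to [h l]. *)
exists (mkpair (A^T *m l) (- dot b l) + mkpair 0 (h l + dot b l)).
  exists l => //; exists (h l + dot b l) => //=.
  by rewrite hE -lerBlDr sub0r le_max lexx orbT.
move=> _ [l' Bl' [s /= s0 <-]]; rewrite -/(dot b l').
have -> : mkpair (A^T *m l) (- dot b l) + mkpair 0 (h l + dot b l) =
    mkpair (A^T *m l) (h l).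
  by rewrite mkpairD addr0 addrCA addNr addr0.
rewrite mkpairD addr0 !dot_mkpair.
apply: le_trans (lmin l' (mem_set Bl')) _; rewrite lerD2l hE.
by case: (leP 0 (- dot b l')) => bl; [nra|rewrite mul0r -expr2 sqr_ge0].
Qed.

(** The product of a point of the epigraphical set with [(- x, 1)] is [s - l^T (A x + b)], which is
    at least [alpha * mu * |(x, 1)|] as [s >= 0]; Cauchy-Schwarz then allows division by
    [|(x, 1)|]. *)
Lemma admissible_radius_le (alpha mu : R) (z : 'cV[R]_(n + 1)) :
  0 <= alpha -> (forall l, B l -> mu <= l1norm l) ->
  admissible_set K A b (alpha *: const_mx 1) -> epigraphical_set A b B z ->
  alpha * mu <= enorm z.
Proof.
move=> alpha0 mumin /(admissible_setP alpha0)[x xB] [l Bl [s /= s0 <-]].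
rewrite -/(dot b l); set z' := _ + _.
have w0 := enorm_mkpair1_gt0 x; rewrite -(ler_pM2r w0).
rewrite -[in leRHS]enorm_mkpairN.
have := cauchy_schwarz_dot z' (mkpair (- x) 1); rewrite dot_epigraph.
move: (xB l Bl) w0; rewrite dotDr (dotC l b) mulmxN dotNr mulr1.
rewrite enorm_mkpairN.
set w := enorm (mkpair x 1) => h w0 h'.
have := ler_wpM2r (ltW w0) (ler_wpM2l alpha0 (mumin l Bl)).
by lra.
Qed.

(* The minimal norm point [p] may have last coordinate [0]; pushing it in the
   direction [(- x0, 1)] of a nominally feasible point [x0] makes it positive
   while keeping [p] nonnegative enough on the epigraphical set. *)
Lemma radius_lt_admissible (alpha M : R) (p : 'cV[R]_(n + 1)) (x0 : 'cV[R]_n) :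
  0 <= alpha -> (forall l, B l -> l1norm l <= M) ->
  (-%R @` K) (A *m x0 + b) ->
  epigraphical_set A b B p ->
  (forall z, epigraphical_set A b B z -> dot p p <= dot z z) ->
  alpha * M < enorm p ->
  admissible_set K A b (alpha *: const_mx 1).
Proof.
move=> alpha0 Mmax /opp_K x0B Ep pmin alphaM; apply/(admissible_setP alpha0).
set d := enorm p in alphaM *.
have dd : d ^+ 2 = dot p p by exact: sqr_enorm.
pose c := enorm (mkpair (- x0) 1).
have c0 : 0 < c by exact: enorm_mkpair1_gt0.
(* This step size makes the perturbation of [p] have norm exactly [d - alpha * M]. *)
pose e := (d - alpha * M) / c.
have e0 : 0 < e by rewrite divr_gt0// subr_gt0.
have ec : e * c = d - alpha * M by rewrite divfK ?gt_eqF.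
pose q := p + e *: mkpair (- x0) 1.
have qd : enorm q <= d + (d - alpha * M).
  by rewrite -ec (le_trans (enormD _ _))// enormZ gtr0_norm.
have p_var z : epigraphical_set A b B z -> d ^+ 2 <= dot p z.
  move=> Ez; rewrite dd; apply: (min_norm_variational pmin) => t t0 t1.
  by apply: epigraphical_set_convex => //; exact: ltW.
have q_var l : B l ->
    d ^+ 2 <= dot q (mkpair (A^T *m l) (- dot b l) + mkpair 0 0).
  move=> Bl; set z := _ + _.
  have Ez : epigraphical_set A b B z by exists l => //; exists 0 => /=.
  rewrite dotDl dotZl [dot _ z in X in _ + X]dotC dot_epigraph.
  have := x0B l Bl; rewrite dotDr (dotC l b) mulmxN dotNr mulr1 => h.
  apply: le_trans (p_var _ Ez) _; rewrite lerDl mulr_ge0 ?(ltW e0)//; lra.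
(* The epigraphical set is stable under upward shifts, so the variational inequality applies at
   [p + (0, 1)]. *)
have p2_ge0 : 0 <= dot p (mkpair 0 1).
  suff /p_var : epigraphical_set A b B (p + mkpair 0 1).
    by rewrite dotDr -dd lerDl.
  have [l Bl [s /= s0 pE]] := Ep; exists l => //; exists (s + 1) => /=.
    exact: addr_ge0.
  by rewrite -pE -addrA [mkpair 0 s + _]mkpairD addr0.
(* Chosen so that [q = q2 *: (- x, 1)]; after multiplication by [q2] the constraint for [l] becomes
   [alpha * |l|_1 * |q| <= q.z], with [z] as in [q_var]. *)
pose q2 := dsubmx q 0 0; pose x := - (q2^-1 *: usubmx q).
have q2_gt0 : 0 < q2.
  rewrite /q2 -dot_mkpair01 dotDl dotZl dot_mkpair dot0r add0r !mulr1.
  exact: ltr_wpDl.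
have qE : mkpair (usubmx q) q2 = q by exact: mkpairK.
have wE : q2 * enorm (mkpair x 1) = enorm q.
  rewrite -{1}(gtr0_norm q2_gt0) -enormZ mkpairZ mulr1 scalerN scalerA.
  by rewrite divff ?gt_eqF// scale1r enorm_mkpairN qE.
exists x => l Bl; rewrite -(ler_pM2l q2_gt0) mulr0 mulrDr.
have -> : q2 * (alpha * (l1norm l * enorm (mkpair x 1))) =
    alpha * l1norm l * enorm q by rewrite -wE; ring.
have -> : q2 * dot l (A *m x + b) = - (dot l (A *m usubmx q) - q2 * dot b l).
  rewrite dotDr mulmxN -scalemxAr dotNr dotZr (dotC l b).
  by field; rewrite gt_eqF.
have := q_var l Bl; rewrite dotC -qE dot_epigraph sub0r qE => h.
have M0 : 0 <= M by apply: le_trans (Mmax l Bl); exact: sumr_ge0.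
have : alpha * l1norm l * enorm q <= alpha * M * (d + (d - alpha * M)).
  apply: ler_pM => //; rewrite ?mulr_ge0 ?sumr_ge0 ?enorm_ge0//.
  by rewrite ler_wpM2l// Mmax.
(* The bound [alpha * M * (2 d - alpha * M) <= d^2] is a perfect square inequality. *)
by have := sqr_ge0 (d - alpha * M); rewrite sqrrB expr2; lra.
Qed.

End RobustRadius.

(** * The two bounds on the radius *)

Theorem theorem3p1 (R : realType) (m n : nat) (K : set 'cV[R]_m)
    (A : 'M[R]_(m, n)) (b : 'cV[R]_m) (B : set 'cV[R]_m)
    (Kclosed : closed K) (Kpointed : pointed K) (Kconvex : convex_set K)
    (Kcone : cone K) (Kint : interior K !=set0)
    (Kneq0 : K <> [set 0]) (KneqT : K <> setT)
    (feasible : [set x : 'cV[R]_n | (-%R @` K) (A *m x + b)] !=set0)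
    (Bbase : compact_base (dual_cone K) B) :
  exists M mu : R,
    [/\ is_max [set v : R | exists (lambda : 'cV[R]_m)
                                   (u : 'I_m -> 'cV[R]_(n + 1)),
                  [/\ B lambda, forall i, enorm (u i) <= 1 &
                      v = enorm (\sum_(i < m) lambda i 0 *: u i)]] M,
        is_min [set \sum_(i < m) `|lambda i 0| | lambda in B] mu,
        0 < M, 0 < mu &
        ((1 / M)%:E * euclid_dist 0 (epigraphical_set A b B)
           <= radius_robust_feasibility K A b
           <= (1 / mu)%:E * euclid_dist 0 (epigraphical_set A b B))%E].
Proof.
have K0 : K !=set0 by case: Kint => k /interior_subset Kk; exists k.
have [cB _ _ nB0 _] := Bbase.
have B0 := compact_base_nonempty Bbase.
have l1c : {within B, continuous (@l1norm R m)}.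
  by apply: continuous_subspaceT => x; exact: l1norm_continuous.
have [lM /set_mem BlM lMmax] := compact_EVT_max B0 cB l1c.
have [lmu /set_mem Blmu lmumin] := compact_EVT_min B0 cB l1c.
have Mmax l : B l -> l1norm l <= l1norm lM by move/mem_set; exact: lMmax.
have mumin l : B l -> l1norm lmu <= l1norm l by move/mem_set; exact: lmumin.
have B_gt0 l : B l -> 0 < l1norm l.
  by move=> Bl; apply: l1norm_gt0 => l0; apply: nB0; rewrite -l0.
have [M_gt0 mu_gt0] := (B_gt0 _ BlM, B_gt0 _ Blmu).
have [p Ep pmin] := ex_min_norm_epigraphical_set A b Bbase.
have [x0 x0feas] := feasible.
exists (l1norm lM), (l1norm lmu); split=> //.
(* The unit vector [(0, 1)] is available even for [n = 0]. *)
- apply: (@is_max_weighted_sum _ _ _ _ _ (mkpair 0 1)) => //.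
  by rewrite enormE dot_mkpair dot0r add0r mulr1 sqrtr1.
- by split=> [|_ [l Bl <-]]; [exists lmu|exact: mumin].
rewrite (euclid_dist_min Ep pmin) -!EFinM; apply/andP; split; last first.
  apply/ereal_supP => _ [alpha [alpha0 adm] <-].
  rewrite lee_fin mulrC div1r ler_pdivlMr//.
  exact: (admissible_radius_le Kclosed Kconvex Kcone K0 Bbase alpha0 mumin adm).
have adm alpha : 0 <= alpha -> alpha * l1norm lM < enorm p ->
    (alpha%:E <= radius_robust_feasibility K A b)%E.
  move=> alpha0 alphaM; apply: ereal_sup_ubound; exists alpha => //; split=> //.
  exact: (radius_lt_admissible Kclosed Kconvex Kcone K0 Bbase _ Mmax x0feas Ep).
have rho_ge0 : (0 <= radius_robust_feasibility K A b)%E.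
  apply: ereal_sup_ubound; exists 0 => //; split=> //.
  apply/(admissible_setP A b Kclosed Kconvex Kcone K0 Bbase (lexx 0)).
  exists x0 => l Bl; rewrite mul0r addr0.
  exact: (opp_coneP Kclosed Kconvex Kcone K0 Bbase _).1 x0feas l Bl.
(* Admissibility was obtained under a strict inequality, so the bound is proved up to each [e > 0];
   if the resulting radius is negative, [rho_ge0] suffices. *)
apply/lee_subgt0Pr => e e0; rewrite -EFinB.
have [dMe|/ltW dMe] := leP 0 (1 / l1norm lM * enorm p - e); last first.
  by rewrite (le_trans _ rho_ge0)// lee_fin.
apply: adm => //; rewrite mulrBl mulrAC div1r mulVf ?gt_eqF// mul1r.
by rewrite ltrBlDr ltrDl mulr_gt0.
Qed.
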